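(* Let $p(x,y,t)$ be the transition density at time $t>0$ of the Brownian swapping process with swap rate $s>0$ started at $(x_0,y_0)$ (described in the context). As $st\to0$, $p(\cdot,\cdot,t)$ converges in $L^1(\mathbb{R}^2)$ to the product of two independent Brownian densities $$p_0(x,y,t)=\frac{1}{2\pi\sigma_1\sigma_2t}\exp\Bigl(-\frac{(x-x_0-\mu_1t)^2}{2\sigma_1^2t}-\frac{(y-y_0-\mu_2t)^2}{2\sigma_2^2t}\Bigr),$$ i.e. $\|p(\cdot,\cdot,t)-p_0(\cdot,\cdot,t)\|_{L^1(\mathbb{R}^2)}\to0$ as $st\to0$.
   Context: The Brownian swapping process with parameters $\mu_1,\mu_2\in\mathbb{R}$, $\sigma_1,\sigma_2>0$, $s>0$ is the càdlàg Markov process $(X,Y)$ on $\mathbb{R}^2$ with $\mathrm{d}X_t=\mu_1\mathrm{d}t+\sigma_1\mathrm{d}W^1_t+(Y_{t-}-X_{t-})\mathrm{d}\mathcal{N}_t$, $\mathrm{d}Y_t=\mu_2\mathrm{d}t+\sigma_2\mathrm{d}W^2_t+(X_{t-}-Y_{t-})\mathrm{d}\mathcal{N}_t$, $(X_0,Y_0)=(x_0,y_0)$, where $W^1,W^2$ are independent standard one-dimensional Brownian motions and $\mathcal{N}$ is an independent Poisson process of rate $s$ (at each jump of $\mathcal{N}$ the two coordinates are exchanged). Its generator is $\mathcal{L}f(x,y)=\mu_1\partial_xf+\mu_2\partial_yf+\frac{\sigma_1^2}{2}\partial_x^2f+\frac{\sigma_2^2}{2}\partial_y^2f+s[f(y,x)-f(x,y)]$.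 *)

(* Defs.v *)
From HB Require Import structures.
From mathcomp Require Import all_boot all_order all_algebra finmap.
From mathcomp Require Import all_classical all_reals all_analysis.

Set Implicit Arguments.
Unset Strict Implicit.
Unset Printing Implicit Defensive.

Import Order.TTheory GRing.Theory Num.Theory.
Import numFieldNormedType.Exports.

Local Open Scope classical_set_scope.
Local Open Scope ring_scope.

Section independence.
Context {d} {T : measurableType d} {R : realType} (P : probability T R).

Definition mutually_independent (I : choiceType) (G : I -> set_system T) :=
  forall (J : {fset I}) (A : I -> set T), (forall i, i \in J -> G i (A i)) ->
    fine (P (\bigcap_(i in [set` J]) A i)) = \prod_(i <- J) fine (P (A i)).

Definition independent_RVs (I : choiceType) (Z : I -> T -> R) :=
  mutually_independent (fun i => g_sigma_algebra_preimage (Z i)).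

(* Processes are indexed by all of R; values at negative times are
   irrelevant, and are never referred to. *)
Definition sigma_process (Z : R -> T -> R) : set_system T :=
  <<s \bigcup_(t in [set t | 0 <= t]) g_sigma_algebra_preimage (Z t) >>.

Definition independent_processes (n : nat) (Z : 'I_n -> R -> T -> R) :=
  mutually_independent (fun i => sigma_process (Z i)).

(* A finite grid 0 <= u 0 <= ... <= u n is the beginning of an infinite one,
   and independence of a sequence concerns its finite subfamilies only. *)
Definition independent_increments (Z : R -> T -> R) :=
  forall u : nat -> R, 0 <= u 0%N -> {homo u : m n / (m <= n)%N >-> m <= n} ->
    independent_RVs (fun n w => Z (u n.+1) w - Z (u n) w).

End independence.

Section paths.
Context {R : realType}.

Definition left_limit (f : R -> R) (t : R) : R := lim (f u @[u --> t^'-]).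

Definition cadlag (f : R -> R) :=
  (forall t, 0 <= t -> f u @[u --> t^'+] --> f t) /\
  (forall t, 0 < t -> cvg (f u @[u --> t^'-])).

Definition counting_path (f : R -> R) :=
  [/\ f 0 = 0, (forall t, 0 <= t -> exists n : nat, f t = n%:R),
      (forall u t, 0 <= u -> u <= t -> f u <= f t) & cadlag f].

(* The pathwise Stieltjes integral of h over ]0, t] against a counting path N,
   i.e. the sum of h over the jump times of N, weighted by the jump sizes.
   A counting path has finitely many jumps in ]0, t], so the finitely supported
   sum is the actual sum (it would be 0 on an infinite support). *)
Definition jump_integral (h N : R -> R) (t : R) : R :=
  \sum_(u \in `]0, t]) (h u * (N u - left_limit N u)).

End paths.

Notation leb2 R :=
  (@lebesgue_measure R \x @lebesgue_measure R)%E.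

Section processes.
Context {d} {T : measurableType d} {R : realType} (P : probability T R).

Definition brownian_motion (W : R -> {RV P >-> R}) :=
  [/\ {ae P, forall w, W 0 w = 0},
      independent_increments P (fun t => W t),
      (forall u t, 0 <= u -> u < t -> forall A : set R, measurable A ->
        P [set w | A (W t w - W u w)] = normal_prob 0 (Num.sqrt (t - u)) A) &
      {ae P, forall w, {within `[0, +oo[, continuous (fun t => W t w)}}].

Definition poisson_process (rate : R) (N : R -> {RV P >-> R}) :=
  [/\ {ae P, forall w, counting_path (fun t => N t w)},
      independent_increments P (fun t => N t) &
      (forall u t, 0 <= u -> u < t -> forall k : nat,
        P [set w | N t w - N u w = k%:R] =
        (poisson_pmf (rate * (t - u)) k)%:E)].

Definition brownian_swapping_process (mu1 mu2 sigma1 sigma2 s x0 y0 : R)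
    (X Y : R -> {RV P >-> R}) :=
  exists W1 W2 N : R -> {RV P >-> R},
    [/\ brownian_motion W1, brownian_motion W2, poisson_process s N,
        independent_processes P (fun i : 'I_3 => fun t =>
          nth (W1 t) [:: W1 t; W2 t; N t] i) &
        {ae P, forall w,
          [/\ cadlag (fun t => X t w), cadlag (fun t => Y t w) &
              forall t, 0 <= t ->
              X t w = x0 + mu1 * t + sigma1 * W1 t w +
                jump_integral
                  (fun u => left_limit (fun r => Y r w) u
                            - left_limit (fun r => X r w) u)
                  (fun u => N u w) t /\
              Y t w = y0 + mu2 * t + sigma2 * W2 t w +
                jump_integral
                  (fun u => left_limit (fun r => X r w) u
                            - left_limit (fun r => Y r w) u)
                  (fun u => N u w) t]}].

(* p x y t is the density of the law of (X_t, Y_t), for every t > 0. *)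
Definition transition_density (X Y : R -> {RV P >-> R})
    (p : R -> R -> R -> R) :=
  forall t, 0 < t ->
    [/\ measurable_fun [set: measurableTypeR R * measurableTypeR R]
          (fun z => p z.1 z.2 t),
        (forall x y, 0 <= p x y t) &
        forall A : set (measurableTypeR R * measurableTypeR R), measurable A ->
          P [set w | A (X t w, Y t w)] =
          (\int[leb2 R]_(z in A) (p z.1 z.2 t)%:E)%E].

End processes.

Definition brownian_product_density {R : realType}
    (mu1 mu2 sigma1 sigma2 x0 y0 x y t : R) : R :=
  1 / (2 * pi * sigma1 * sigma2 * t) *
  expR (- ((x - x0 - mu1 * t) ^+ 2 / (2 * sigma1 ^+ 2 * t))
        - (y - y0 - mu2 * t) ^+ 2 / (2 * sigma2 ^+ 2 * t)).

(* Main.v *)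
Require Import Defs.
From HB Require Import structures.
From mathcomp Require Import all_boot all_order all_algebra finmap.
From mathcomp Require Import all_classical all_reals all_analysis.
From mathcomp Require Import measurable_realfun ring lra.

Import Order.TTheory GRing.Theory Num.Theory.
Import numFieldNormedType.Exports.

Local Open Scope classical_set_scope.
Local Open Scope ring_scope.

(** The proof is a coupling on the probability space of the swapping process
    itself.  Compare (X_t, Y_t) with the pair that is never swapped,
    B1 = x0 + mu1 t + sigma1 W1_t and B2 = y0 + mu2 t + sigma2 W2_t.  If the
    Poisson clock N has not rung by time t, the jump integrals vanish and the
    two pairs coincide ([swapping_process_no_jump]).  The clock rings with
    probability 1 - exp (- s t) <= s t ([poisson_jump_prob]), so for every
    Borel set the probabilities that the two pairs fall into it differ by at
    most s t.

    The pair (B1, B2) has density p0 ([unswapped_pair_density]): its marginals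
    are affine images of centred Gaussian laws ([normal_prob_affine]), hence
    Gaussian, and by independence the joint law is determined by its values
    on rectangles ([joint_density]).

    Finally, two densities whose integrals over every measurable set differ by
    at most c are at L1 distance at most 2 c ([L1_le_of_setwise]); so the L1
    distance is at most 2 s t, and delta = eps / 2 works. *)

Set Implicit Arguments.
Unset Strict Implicit.

(** * Affine images of Gaussian laws *)

Lemma measurable_event d d' (T : measurableType d) (T' : measurableType d')
    (Z : T -> T') (C : set T') :
  measurable_fun setT Z -> measurable C -> measurable [set w | C (Z w)].
Proof. by move=> mZ mC; rewrite -[X in measurable X]setTI; exact: mZ. Qed.

Section affine.
Context {R : realType} (m k : R).

Definition affine (x : measurableTypeR R) : measurableTypeR R := m + k * x.

Lemma measurable_affine : measurable_fun [set: measurableTypeR R] affine.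
Proof. by apply: measurable_funD => //; exact: measurable_funM. Qed.

HB.instance Definition _ :=
  isMeasurableFun.Build _ _ _ _ affine measurable_affine.

End affine.

(** Both sides are measures, and half-open intervals determine them. *)
Lemma lebesgue_measure_affine (R : realType) (m k : R) (k0 : 0 < k)
    (A : set (measurableTypeR R)) : measurable A ->
  lebesgue_measure A =
  (k%:E * lebesgue_measure (affine m k @^-1` A))%E.
Proof.
move=> mA.
have k0' : 0 <= k by exact: ltW.
pose K := NngNum k0'.
apply: (@lebesgue_measure_unique R
  (mscale K (pushforward lebesgue_measure (affine m k)))) => // _ [[a b]] _ <-.
rewrite /= /mscale /= /pushforward.
have -> : affine m k @^-1` `]a, b] =
    `](a - m) / k, (b - m) / k]%classic.
  apply/seteqP; split => x /=; rewrite /affine !in_itv /= ltr_pdivrMr//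
    ler_pdivlMr// => /andP[? ?]; apply/andP; split; lra.
rewrite !lebesgue_measure_itv /= !lte_fin ltr_pM2r ?invr_gt0// ltrD2r.
case: ifP => _; last by rewrite mule0.
rewrite -!EFinB -EFinM; congr EFin; field.
by rewrite gt_eqF.
Qed.

(** This is the change of variables x |-> m + k x in the Gaussian density; the
    Jacobian k is absorbed by the normalising constant. *)
Lemma normal_prob_affine (R : realType) (m k s : R)
    (A : set (measurableTypeR R)) :
  0 < k -> 0 < s -> measurable A ->
  normal_prob 0 s (affine m k @^-1` A) = normal_prob m (k * s) A.
Proof.
move=> k0 s0 mA; rewrite /normal_prob.
have k0' : 0 <= k by exact: ltW.
pose K := NngNum k0'.
have mpdf (c e : R) (B : set (measurableTypeR R)) : measurable B ->
    measurable_fun B (fun x => (normal_pdf c e x)%:E).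
  by move=> mB; apply/measurable_EFinP/measurable_funTS;
    exact: measurable_normal_pdf.
rewrite [RHS](@eq_measure_integral _ _ _ _
  (mscale K (pushforward lebesgue_measure (affine m k)))); last first.
  by move=> B mB _; exact: lebesgue_measure_affine.
rewrite ge0_integral_mscale//=; last 2 first.
- exact: mpdf.
- by move=> x _; rewrite lee_fin normal_pdf_ge0.
rewrite ge0_integral_pushforward//=; last 2 first.
- exact: mpdf.
- by move=> x _; rewrite lee_fin normal_pdf_ge0.
have mpA : measurable (affine m k @^-1` A).
  exact: (measurable_event (@measurable_affine R m k)).
rewrite -ge0_integralZl//=; last 2 first.
- apply/measurable_EFinP; apply: measurable_funTS.
  by apply: measurableT_comp => //; exact: measurable_normal_pdf.
- by move=> x _; rewrite lee_fin normal_pdf_ge0.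
apply: eq_integral => x _; rewrite -EFinM; congr EFin.
have ks0 : k * s != 0 by rewrite mulf_neq0 ?gt_eqF.
rewrite !normal_pdfE ?(gt_eqF s0) //= /normal_peak /normal_fun /affine mulrA.
congr (_ * expR _).
  have -> : (k * s) ^+ 2 * pi *+ 2 = k ^+ 2 * (s ^+ 2 * pi *+ 2) by ring.
  rewrite (sqrtrM _ (sqr_ge0 k)) sqrtr_sqr ger0_norm// invfM mulrA.
  by rewrite mulfV ?mul1r// gt_eqF.
by field; rewrite !gt_eqF.
Qed.

(** * Densities on the plane and total variation *)

(** The coupling inequality.  It serves twice: with G the event that the clock
    has rung, and with G empty to identify almost surely equal events. *)
Lemma le_measure_ae d (T : measurableType d) (R : realType)
    (P : {measure set T -> \bar R}) (E F G : set T) :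
  measurable E -> measurable F -> measurable G ->
  {ae P, forall w, ~ G w -> E w -> F w} -> (P E <= P F + P G)%E.
Proof.
move=> mE mF mG [N [mN N0 sub]].
rewrite -[leRHS]adde0 -N0.
apply: (@le_trans _ _ (P (F `|` G `|` N))).
  apply: le_measure; rewrite ?inE//.
    by apply: measurableU => //; exact: measurableU.
  move=> w Ew; have [Gw|nGw] := pselect (G w); first by left; right.
  have [Fw|nFw] := pselect (F w); first by left; left.
  by right; apply: sub => /= H; apply: nFw; exact: H.
apply: (le_trans (measureU2 _ _ _)) => //; first exact: measurableU.
by rewrite leeD2r// measureU2.
Qed.

(** Splitting the space according to the sign of f - g, the integral of
    |f - g| is a sum of two set differences, each bounded by c.  Finiteness of
    the integrals is what allows subtracting them. *)
Lemma L1_le_of_setwise d (T : measurableType d) (R : realType)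
    (mu : {measure set T -> \bar R}) (f g : T -> R) (c : R) :
  measurable_fun setT f -> measurable_fun setT g ->
  (forall x, 0 <= f x) -> (forall x, 0 <= g x) ->
  (\int[mu]_x (f x)%:E < +oo)%E -> (\int[mu]_x (g x)%:E < +oo)%E ->
  (forall A, measurable A ->
     \int[mu]_(x in A) (f x)%:E <= \int[mu]_(x in A) (g x)%:E + c%:E)%E ->
  (forall A, measurable A ->
     \int[mu]_(x in A) (g x)%:E <= \int[mu]_(x in A) (f x)%:E + c%:E)%E ->
  (\int[mu]_x `|(f x - g x)%:E| <= (2 * c)%:E)%E.
Proof.
move=> mf mg f0 g0 fy gy fg gf.
pose A := [set x | g x <= f x].
have mA : measurable A.
  rewrite -[A]setTI; exact: measurable_fun_le.
have half (u v : T -> R) (D : set T) : measurable D ->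
    measurable_fun setT u -> measurable_fun setT v -> (forall x, 0 <= v x) ->
    (\int[mu]_x (v x)%:E < +oo)%E -> (forall x, D x -> v x <= u x) ->
    (\int[mu]_(x in D) (u x)%:E <= \int[mu]_(x in D) (v x)%:E + c%:E)%E ->
    (\int[mu]_(x in D) `|(u x - v x)%:E| <= c%:E)%E.
  move=> mD mu' mv v0 vy vu uv.
  have vfin : (\int[mu]_(x in D) (v x)%:E)%E \is a fin_num.
    rewrite ge0_fin_numE; last by apply: integral_ge0 => x _; rewrite lee_fin.
    apply: le_lt_trans vy; apply: ge0_subset_integral => //.
      exact/measurable_EFinP.
    by move=> x _; rewrite lee_fin.
  rewrite -(@leeD2rE _ (\int[mu]_(x in D) (v x)%:E)%E)// [leRHS]addeC.
  apply: le_trans uv; rewrite -ge0_integralD//.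
  - rewrite le_eqVlt; apply/orP; left; apply/eqP.
    apply: eq_integral => x /[!inE] Dx.
    by rewrite /= ger0_norm ?subr_ge0 ?vu// -EFinD subrK.
  - apply: measurableT_comp => //; apply/measurable_EFinP.
    by apply: measurable_funTS; exact: measurable_funB.
  - by move=> x _; rewrite lee_fin.
  - by apply/measurable_EFinP; exact: measurable_funTS.
rewrite -(setUv A) ge0_integral_setU//=; last 3 first.
- exact: measurableC.
- rewrite setUv; apply/measurable_EFinP/measurableT_comp => //.
  exact: measurable_funB.
- by apply/disj_setPCl.
rewrite mulr_natl mulr2n EFinD; apply: leeD.
  by apply: half => //; exact: fg.
under eq_integral do rewrite distrC.
apply: half => //; [exact: measurableC| |exact/gf/measurableC].
by move=> x /negP; rewrite -ltNge => /ltW.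
Qed.

(** The law of (U, V) and the measure with density f(x) g(y) agree on
    rectangles, by Tonelli, hence on all Borel sets of the plane. *)
Lemma joint_density d (T : measurableType d) (R : realType)
    (P : probability T R) (U V : T -> measurableTypeR R) (f g : R -> R) :
  measurable_fun setT U -> measurable_fun setT V ->
  measurable_fun setT f -> measurable_fun setT g ->
  (forall x, 0 <= f x) -> (forall x, 0 <= g x) ->
  (forall A B : set (measurableTypeR R), measurable A -> measurable B ->
    P [set w | A (U w) /\ B (V w)] =
    (\int[lebesgue_measure]_(x in A) (f x)%:E *
     \int[lebesgue_measure]_(y in B) (g y)%:E)%E) ->
  forall C : set (measurableTypeR R * measurableTypeR R), measurable C ->
    P [set w | C (U w, V w)] =
    (\int[leb2 R]_(z in C) (f z.1 * g z.2)%:E)%E.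
Proof.
move=> mU mV mf mg f0 g0 rect C mC.
pose h (z : measurableTypeR R * measurableTypeR R) : \bar R :=
  (f z.1 * g z.2)%:E.
have mh : measurable_fun setT h.
  apply/measurable_EFinP/measurable_funM.
    exact: measurableT_comp mf measurable_fst.
  exact: measurableT_comp mg measurable_snd.
have h0 z : (0 <= h z)%E by rewrite lee_fin mulr_ge0.
pose nu (A : set (measurableTypeR R * measurableTypeR R)) :=
  (\int[leb2 R]_(z in A) h z)%E.
pose nuM : {measure set (measurableTypeR R * measurableTypeR R) -> \bar R} :=
  HB.pack nu (isMeasure.Build _ _ _ nu (integral_set0 _ _)
    (fun A => integral_ge0 (leb2 R) (fun x _ => h0 x))
    (semi_sigma_additive_nng_induced mh h0)).
have mUV : measurable_fun setT
    ((fun w => (U w, V w)) : T -> measurableTypeR R * measurableTypeR R).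
  exact: measurable_fun_pair.
pose UV : {mfun T >-> (measurableTypeR R * measurableTypeR R)%type} :=
  HB.pack (_ : T -> measurableTypeR R * measurableTypeR R)
    (isMeasurableFun.Build _ _ _ _ _ mUV).
pose G : set (set (measurableTypeR R * measurableTypeR R)) :=
   [set A `*` B | A in measurable & B in measurable].
(* rectangles form a pi-system generating the product sigma-algebra *)
apply: (@measure_unique _ _ _ G (fun=> setT) _ _ _ _
  (distribution P UV) nuM) => //.
- exact: measurable_prod_measurableType.
- move=> _ _ [A mA [B mB <-]] [A' mA' [B' mB' <-]].
  rewrite -setXI; exists (A `&` A'); first exact: measurableI.
  by exists (B `&` B') => //; exact: measurableI.
- by move=> _; exists setT => //; exists setT => //; rewrite setXTT.
- by rewrite bigcup_const.
- move=> _ [A mA [B mB <-]].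
  rewrite /distribution /pushforward /=; rewrite [LHS](rect A B mA mB).
  have split_rect x y : (h \_ (A `*` B)) (x, y) =
      (((EFin \o f) \_ A) x * ((EFin \o g) \_ B) y)%E.
    rewrite !patchE in_setX /=.
    by case: (x \in A); case: (y \in B); rewrite ?mul0e ?mule0.
  have mfA : measurable_fun setT ((EFin \o f) \_ A).
    by apply/(measurable_restrictT _ mA)/measurable_EFinP/measurable_funTS.
  have mgB : measurable_fun setT ((EFin \o g) \_ B).
    by apply/(measurable_restrictT _ mB)/measurable_EFinP/measurable_funTS.
  have fA0 x : (0 <= ((EFin \o f) \_ A) x)%E.
    by rewrite patchE; case: ifP => // _; rewrite lee_fin.
  have gB0 x : (0 <= ((EFin \o g) \_ B) x)%E.
    by rewrite patchE; case: ifP => // _; rewrite lee_fin.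
  rewrite /nu [RHS]integral_mkcond fubini_tonelli1; last 2 first.
  + apply/(measurable_restrictT _ (measurableX mA mB)).
    exact: measurable_funTS.
  + by move=> [x y]; rewrite split_rect mule_ge0.
  rewrite [X in (X * _)%E]integral_mkcond [X in (_ * X)%E]integral_mkcond.
  rewrite -ge0_integralZr//; last exact: integral_ge0.
  apply: eq_integral => x _; rewrite /fubini_F.
  rewrite -ge0_integralZl//.
  by apply: eq_integral => y _; exact/esym/split_rect.
- by move=> _; rewrite (le_lt_trans (probability_le1 _ _))// ltry.
Qed.

Lemma normal_pdf_prod (R : realType) (mu1 mu2 sigma1 sigma2 x0 y0 x y t : R) :
  0 < sigma1 -> 0 < sigma2 -> 0 < t ->
  normal_pdf (x0 + mu1 * t) (sigma1 * Num.sqrt t) x *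
  normal_pdf (y0 + mu2 * t) (sigma2 * Num.sqrt t) y =
  brownian_product_density mu1 mu2 sigma1 sigma2 x0 y0 x y t.
Proof.
move=> s1 s2 t0.
have rt : 0 < Num.sqrt t by rewrite sqrtr_gt0.
have rt2 : Num.sqrt t ^+ 2 = t by rewrite sqr_sqrtr// ltW.
rewrite !normal_pdfE ?(gt_eqF (mulr_gt0 _ _))//= /normal_peak /normal_fun.
rewrite mulrACA -expRD /brownian_product_density !exprMn rt2.
congr (_ * expR _).
  rewrite -invfM -sqrtrM; last first.
    by rewrite mulrn_wge0// !mulr_ge0 ?sqr_ge0 ?pi_ge0// ltW.
  have -> : (sigma1 ^+ 2 * t * pi *+ 2) * (sigma2 ^+ 2 * t * pi *+ 2) =
     (2 * pi * sigma1 * sigma2 * t) ^+ 2 by ring.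
  by rewrite sqrtr_sqr ger0_norm ?div1r// !mulr_ge0 ?pi_ge0// ltW.
by field; rewrite !gt_eqF.
Qed.

(** * The driving processes *)

(** The definition prescribes the law of the increment W_t - W_0, and W_0
    vanishes almost surely. *)
Lemma brownian_marginal d (T : measurableType d) (R : realType)
    (P : probability T R) (W : R -> {RV P >-> R}) (t : R) (A : set R) :
  brownian_motion W -> 0 < t -> measurable A ->
  P [set w | A (W t w)] = normal_prob 0 (Num.sqrt t) A.
Proof.
move=> [W0 _ law _] t0 mA.
have mpre (Z : {RV P >-> R}) : measurable [set w | A (Z w)].
  exact: (measurable_event (measurable_funPT Z)).
have := law 0 t (lexx _) t0 A mA; rewrite subr0 => <-.
pose Z := (W t \- W 0%R : {mfun T >-> R}).
apply/le_anti/andP; split.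
  rewrite -[leRHS]adde0 -(measure0 P).
  apply: le_measure_ae => //; first exact: (mpre Z).
  by apply: filterS W0 => w /= -> _; rewrite subr0.
rewrite -[leRHS]adde0 -(measure0 P).
apply: le_measure_ae => //; first exact: (mpre Z).
by apply: filterS W0 => w /= -> _; rewrite subr0.
Qed.

(** Independence of whole processes is used only for two of them and at one
    time: take the subfamily {i, j} and events on the values at time t. *)
Lemma independent_processes_marginals d (T : measurableType d) (R : realType)
    (P : probability T R) (n : nat) (Z : 'I_n -> R -> {RV P >-> R})
    (i j : 'I_n) (t : R) (A B : set R) :
  independent_processes P (fun k u => Z k u) -> i != j -> 0 <= t ->
  measurable A -> measurable B ->
  P [set w | A (Z i t w) /\ B (Z j t w)] =
  (P [set w | A (Z i t w)] * P [set w | B (Z j t w)])%E.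
Proof.
move=> ind ij t0 mA mB.
pose C k := if k == i then [set w | A (Z i t w)] else [set w | B (Z j t w)].
have Ci : C i = [set w | A (Z i t w)] by rewrite /C eqxx.
have Cj : C j = [set w | B (Z j t w)] by rewrite /C eq_sym (negbTE ij).
have sigmaZ k (D : set R) : measurable D ->
    sigma_process (fun u => Z k u) [set w | D (Z k t w)].
  move=> mD; apply: sub_sigma_algebra; exists t => //=.
  by exists D => //; rewrite setTI.
have := ind [fset i; j]%fset C.
have capE : \bigcap_(k in [set` [fset i; j]%fset]) C k =
    [set w | A (Z i t w) /\ B (Z j t w)].
  apply/seteqP; split => w /=.
    move=> H; have := H i; have := H j; rewrite /= !inE !eqxx orbT Ci Cj.
    by move=> /(_ isT) ? /(_ isT) ?.
  move=> [Aw Bw] k; rewrite /= !inE => /orP[] /eqP ->; first by rewrite Ci.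
  by rewrite Cj.
rewrite capE big_fsetU1/= ?inE// big_seq_fset1 Ci Cj => H.
have mAi := measurable_event (measurable_funPT (Z i t)) mA.
have mBj := measurable_event (measurable_funPT (Z j t)) mB.
rewrite -[LHS]fineK; last by apply: fin_num_measure; exact: measurableI.
rewrite H ?EFinM ?fineK//; [exact: fin_num_measure..|].
by move=> k; rewrite !inE => /orP[] /eqP ->; rewrite ?Ci ?Cj; exact: sigmaZ.
Qed.

Lemma poisson_jump_prob d (T : measurableType d) (R : realType)
    (P : probability T R) (N : R -> {RV P >-> R}) (s t : R) :
  poisson_process s N -> 0 < s -> 0 < t ->
  measurable [set w | N t w <> N 0 w] /\
  (P [set w | N t w <> N 0%R w] <= (s * t)%:E)%E.
Proof.
move=> [_ _ law] s0 t0.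
have mE : measurable [set w | N t w - N 0 w = 0%:R].
  pose Z := (N t \- N 0%R : {mfun T >-> R}).
  exact: (measurable_event (measurable_funPT Z) (measurable_set1 _)).
have -> : [set w | N t w <> N 0 w] = ~` [set w | N t w - N 0 w = 0%:R].
  apply/seteqP; split => w /= H /eqP K; apply: H; apply/eqP.
    by rewrite -subr_eq0.
  by rewrite subr_eq0.
split; first exact: measurableC.
rewrite probability_setC// (law 0 t (lexx _) t0 0%N) /poisson_pmf subr0.
rewrite mulr_gt0//.
rewrite expr0 fact0 invr1 !mul1r -EFinB lee_fin lerBlDl -lerBlDr.
exact: expR_ge1Dx.
Qed.

(** * Without jumps, no swap *)

(** Both N u and its left limit vanish on ]0, t], so every term of the sum
    does. *)
Lemma jump_integral_eq0 (R : realType) (h N : R -> R) (t : R) :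
  (forall u, 0 <= u <= t -> N u = 0) -> jump_integral h N t = 0.
Proof.
move=> N0; rewrite /jump_integral fsbig1// => u /=.
rewrite in_itv/= => /andP[u0 ut].
rewrite N0 ?(ltW u0)//; suff -> : left_limit N u = 0 by rewrite subr0 mulr0.
apply: cvg_lim => //; apply: cvg_near_cst.
near=> r; apply: N0; apply/andP; split.
  by apply: ltW; near: r; exact: nbhs_left_gt.
by apply: le_trans ut; near: r; exact: nbhs_left_le.
Unshelve. all: by end_near. Qed.

(** A counting path is monotone, so one that starts and ends at 0 stays
    there. *)
Lemma counting_path_eq0 (R : realType) (N : R -> R) (t : R) : counting_path N ->
  N t = N 0 -> forall u, 0 <= u <= t -> N u = 0.
Proof.
move=> [N0 _ mono _] Nt u /andP[u0 ut]; apply/le_anti/andP; split.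
  by rewrite -N0 -Nt mono.
by rewrite -N0 mono.
Qed.

(** The equations of the process, read on the event that the Poisson clock has
    not rung by time t, contain no swap term. *)
Lemma swapping_process_no_jump d (T : measurableType d) (R : realType)
    (P : probability T R) (mu1 mu2 sigma1 sigma2 s x0 y0 : R)
    (X Y : R -> {RV P >-> R}) (t : R) :
  0 <= t ->
  brownian_swapping_process mu1 mu2 sigma1 sigma2 s x0 y0 X Y ->
  exists W1 W2 N : R -> {RV P >-> R},
    [/\ brownian_motion W1, brownian_motion W2, poisson_process s N,
        independent_processes P (fun i : 'I_3 => fun t =>
          nth (W1 t) [:: W1 t; W2 t; N t] i) &
        {ae P, forall w, N t w = N 0 w ->
          X t w = affine (x0 + mu1 * t) sigma1 (W1 t w) /\
          Y t w = affine (y0 + mu2 * t) sigma2 (W2 t w)}].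
Proof.
move=> t0 [W1 [W2 [N [bW1 bW2 pN ind dyn]]]]; exists W1, W2, N; split => //.
have [cN _ _] := pN.
apply: filterS2 dyn cN => w [_ _ /(_ t t0)[-> ->]] cN Nt.
by rewrite !jump_integral_eq0 ?addr0//; exact: counting_path_eq0.
Qed.

(** * The limit *)

(** Shifting and scaling each of two independent Brownian marginals yields a
    pair with density p0; independence enters only through the product rule
    on rectangles at the single time t. *)
Lemma unswapped_pair_density d (T : measurableType d) (R : realType)
    (P : probability T R) (mu1 mu2 sigma1 sigma2 x0 y0 t : R)
    (W1 W2 : R -> {RV P >-> R}) :
  0 < sigma1 -> 0 < sigma2 -> 0 < t ->
  brownian_motion W1 -> brownian_motion W2 ->
  (forall A B : set R, measurable A -> measurable B ->
    P [set w | A (W1 t w) /\ B (W2 t w)] =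
    (P [set w | A (W1 t w)] * P [set w | B (W2 t w)])%E) ->
  forall C : set (measurableTypeR R * measurableTypeR R), measurable C ->
    P [set w | C (affine (x0 + mu1 * t) sigma1 (W1 t w),
                  affine (y0 + mu2 * t) sigma2 (W2 t w))] =
    (\int[leb2 R]_(z in C) (brownian_product_density
       mu1 mu2 sigma1 sigma2 x0 y0 z.1 z.2 t)%:E)%E.
Proof.
move=> s1 s2 t0 bW1 bW2 ind C mC.
have rt : 0 < Num.sqrt t by rewrite sqrtr_gt0.
have mB (m k : R) (W : {RV P >-> R}) :
    measurable_fun setT (fun w => affine m k (W w)).
  apply: measurableT_comp; first exact: measurable_affine.
  exact: (measurable_funPT W).
rewrite (joint_density (mB _ _ (W1 t)) (mB _ _ (W2 t))
  (@measurable_normal_pdf R (x0 + mu1 * t) (sigma1 * Num.sqrt t))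
  (@measurable_normal_pdf R (y0 + mu2 * t) (sigma2 * Num.sqrt t))
  (@normal_pdf_ge0 R _ _) (@normal_pdf_ge0 R _ _) _ mC).
  by apply: eq_integral => z _; rewrite normal_pdf_prod.
move=> A B mA mB'.
have mpre (m k : R) (D : set (measurableTypeR R)) : measurable D ->
    measurable (affine m k @^-1` D).
  exact: (measurable_event (@measurable_affine R m k)).
have := ind _ _ (mpre (x0 + mu1 * t) sigma1 _ mA)
  (mpre (y0 + mu2 * t) sigma2 _ mB').
rewrite /= => ->.
rewrite (brownian_marginal bW1 t0 (mpre _ _ _ mA)).
rewrite (brownian_marginal bW2 t0 (mpre _ _ _ mB')).
by rewrite !normal_prob_affine.
Qed.

Lemma measurable_brownian_product_density (R : realType)
    (mu1 mu2 sigma1 sigma2 x0 y0 t : R) :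
  0 < sigma1 -> 0 < sigma2 -> 0 < t ->
  measurable_fun setT (fun z : measurableTypeR R * measurableTypeR R =>
    brownian_product_density mu1 mu2 sigma1 sigma2 x0 y0 z.1 z.2 t).
Proof.
move=> s1 s2 t0; under eq_fun do rewrite -normal_pdf_prod//.
apply: measurable_funM.
  exact: measurableT_comp (@measurable_normal_pdf R _ _) measurable_fst.
exact: measurableT_comp (@measurable_normal_pdf R _ _) measurable_snd.
Qed.

Unset Implicit Arguments.
Set Strict Implicit.

Theorem proposition5p4 (R : realType) (mu1 mu2 sigma1 sigma2 x0 y0 : R)
    (hsigma1 : 0 < sigma1) (hsigma2 : 0 < sigma2) :
  forall eps : R, 0 < eps -> exists delta : R, 0 < delta /\
    forall (s t : R), 0 < s -> 0 < t -> s * t < delta ->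
    forall (d : measure_display) (T : measurableType d) (P : probability T R)
      (X Y : R -> {RV P >-> R}) (p : R -> R -> R -> R),
      brownian_swapping_process mu1 mu2 sigma1 sigma2 s x0 y0 X Y ->
      transition_density X Y p ->
      ('N[leb2 R]_1[(fun z : measurableTypeR R * measurableTypeR R =>
         (p z.1 z.2 t - brownian_product_density
            mu1 mu2 sigma1 sigma2 x0 y0 z.1 z.2 t)%:E)]
       < eps%:E)%E.
Proof.
move=> eps eps0; exists (eps / 2); split; first by rewrite divr_gt0.
move=> s t s0 t0 st d T P X Y p bsp /(_ t t0)[mp p0 pE].
have [W1 [W2 [N [bW1 bW2 pN ind coupling]]]] :=
  swapping_process_no_jump (ltW t0) bsp.
have [mJ PJ] := poisson_jump_prob pN s0 t0.
pose B1 w := affine (x0 + mu1 * t) sigma1 (W1 t w).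
pose B2 w := affine (y0 + mu2 * t) sigma2 (W2 t w).
pose q (z : measurableTypeR R * measurableTypeR R) :=
  brownian_product_density mu1 mu2 sigma1 sigma2 x0 y0 z.1 z.2 t.
have qE (C : set (measurableTypeR R * measurableTypeR R)) : measurable C ->
    P [set w | C (B1 w, B2 w)] = (\int[leb2 R]_(z in C) (q z)%:E)%E.
  move=> mC; apply: unswapped_pair_density => // A B mA mB.
  exact: (@independent_processes_marginals _ _ _ P 3
    (fun i u => nth (W1 u) [:: W1 u; W2 u; N u] i)
    (@Ordinal 3 0 isT) (@Ordinal 3 1 isT) t A B ind isT (ltW t0) mA mB).
have q0 z : 0 <= q z by rewrite /q -normal_pdf_prod// mulr_ge0 ?normal_pdf_ge0.
have mXY : measurable_fun setT
    ((fun w => (X t w, Y t w)) : T -> measurableTypeR R * measurableTypeR R).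
  by apply: measurable_fun_pair;
    [exact: (measurable_funPT (X t))|exact: (measurable_funPT (Y t))].
have mB : measurable_fun setT
    ((fun w => (B1 w, B2 w)) : T -> measurableTypeR R * measurableTypeR R).
  apply: measurable_fun_pair; (apply: measurableT_comp;
    first exact: measurable_affine).
    exact: (measurable_funPT (W1 t)).
  exact: (measurable_funPT (W2 t)).
rewrite Lnorm1.
apply: (@le_lt_trans _ _ (2 * (s * t))%:E); last by rewrite lte_fin; lra.
apply: (@L1_le_of_setwise _ _ R (leb2 R) (fun z => p z.1 z.2 t) q (s * t))
  => //.
- exact: measurable_brownian_product_density.
- rewrite -pE// (le_lt_trans (probability_le1 _ _))// ?ltry//.
  exact: (measurable_event mXY).
- rewrite -qE// (le_lt_trans (probability_le1 _ _))// ?ltry//.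
  exact: (measurable_event mB).
- move=> C mC; rewrite -pE// -qE//; apply: le_trans (leeD2l _ PJ).
  apply: le_measure_ae => //.
  + exact: (measurable_event mXY).
  + exact: (measurable_event mB).
  + by apply: filterS coupling => w XY /= /contrapT /XY[-> ->].
- move=> C mC; rewrite -pE// -qE//; apply: le_trans (leeD2l _ PJ).
  apply: le_measure_ae => //.
  + exact: (measurable_event mB).
  + exact: (measurable_event mXY).
  + by apply: filterS coupling => w XY /= /contrapT /XY[-> ->].
Qed.
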